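(* Let $(E,S,P)$ be a pmf-structure (as defined in the context) and let $x,y\in E$. Call $x$ and $y$ independent if $P(x\wedge y)=P(x)\cdot P(y)$. Then $x$ and $y$ are independent if and only if $P(x\mid y)=P(x)\cdot P(y\mid y)$, and also if and only if $P(y\mid x)=P(y)\cdot P(x\mid x)$.
   Context: Two-sorted signature: an event sort $E$ with binary operations $\vee,\wedge$, unary $\neg$, constants $\top,\bot$; a stalk sort $S$ with binary $+,\cdot$, unary $-$ (additive inverse), unary ${}^{-1}$ (inverse), unary $\mathbf{s}$ (sign), constants $0,1$; and a function $P:E\to S$. Abbreviations: $p-q=p+(-q)$, $1_p=p\cdot p^{-1}$, $0_p=1-1_p$, $\frac{p}{q}=p\cdot q^{-1}$, $P(x\mid y)=\frac{P(x\wedge y)}{P(y)}$. A pmf-structure is a structure for this signature satisfying, for all values of the variables, the following equations. Boolean algebra: $(x\vee y)\wedge y=y$; $(x\wedge y)\vee y=y$; $x\wedge(y\vee z)=(y\wedge x)\vee(z\wedge x)$; $x\vee(y\wedge z)=(y\vee x)\wedge(z\vee x)$; $x\wedge\neg x=\bot$; $x\vee\neg x=\top$. Meadow: $(x+y)+z=x+(y+z)$; $x+y=y+x$; $x+0=x$; $x+(-x)=0$; $(x\cdot y)\cdot z=x\cdot(y\cdot z)$; $x\cdot y=y\cdot x$; $1\cdot x=x$; $x\cdot(y+z)=x\cdot y+x\cdot z$; $(x^{-1})^{-1}=x$; $x\cdot(x\cdot x^{-1})=x$. Sign: $\mathbf{s}(1_x)=1_x$; $\mathbf{s}(0_x)=0_x$;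 $\mathbf{s}(-1)=-1$; $\mathbf{s}(x^{-1})=\mathbf{s}(x)$; $\mathbf{s}(x\cdot y)=\mathbf{s}(x)\cdot\mathbf{s}(y)$; $0_{\mathbf{s}(x)-\mathbf{s}(y)}\cdot(\mathbf{s}(x+y)-\mathbf{s}(x))=0$. Pmf (with $x,y$ events): $P(\top)=1$; $P(\bot)=0$; $\mathbf{s}(\mathbf{s}(P(x))+1)=1$; $P(x\vee y)=P(x)+P(y)-P(x\wedge y)$; $P(x\wedge y)\cdot P(y)\cdot P(y)^{-1}=P(x\wedge y)$. *)

(* Defs.v *)
Record pmf_signature : Type := PmfSignature {
  event : Type;
  stalk : Type;
  ejoin : event -> event -> event;
  emeet : event -> event -> event;
  eneg  : event -> event;
  etop  : event;
  ebot  : event;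
  sadd  : stalk -> stalk -> stalk;
  smul  : stalk -> stalk -> stalk;
  sopp  : stalk -> stalk;
  sinv  : stalk -> stalk;
  sign  : stalk -> stalk;
  szero : stalk;
  sone  : stalk;
  prob  : event -> stalk
}.

Arguments ejoin {_} _ _.
Arguments emeet {_} _ _.
Arguments eneg {_} _.
Arguments etop {_}.
Arguments ebot {_}.
Arguments sadd {_} _ _.
Arguments smul {_} _ _.
Arguments sopp {_} _.
Arguments sinv {_} _.
Arguments sign {_} _.
Arguments szero {_}.
Arguments sone {_}.
Arguments prob {_} _.

Declare Scope event_scope.
Delimit Scope event_scope with ev.
Bind Scope event_scope with event.
Declare Scope stalk_scope.
Delimit Scope stalk_scope with st.
Bind Scope stalk_scope with stalk.

Notation "x ∨ y" := (ejoin x y)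
  (at level 50, left associativity) : event_scope.
Notation "x ∧ y" := (emeet x y)
  (at level 40, left associativity) : event_scope.
Notation "¬ x" := (eneg x) (at level 35, right associativity) : event_scope.
Notation "⊤" := etop : event_scope.
Notation "⊥" := ebot : event_scope.

Notation "p + q" := (sadd p q) : stalk_scope.
Notation "p * q" := (smul p q) : stalk_scope.
Notation "- p" := (sopp p) : stalk_scope.
Notation "p ⁻¹" := (sinv p)
  (at level 2, left associativity, format "p ⁻¹") : stalk_scope.
Notation "0" := szero : stalk_scope.
Notation "1" := sone : stalk_scope.

Open Scope event_scope.
Open Scope stalk_scope.

Definition ssub {M : pmf_signature} (p q : stalk M) : stalk M := p + - q.
Notation "p - q" := (ssub p q) : stalk_scope.

Definition sdiv {M : pmf_signature} (p q : stalk M) : stalk M := p * q⁻¹.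
Notation "p / q" := (sdiv p q) : stalk_scope.

(* the indexed constants 1_p and 0_p *)
Definition one_at {M : pmf_signature} (p : stalk M) : stalk M := p * p⁻¹.
Definition zero_at {M : pmf_signature} (p : stalk M) : stalk M := 1 - one_at p.

Definition cond_prob {M : pmf_signature} (x y : event M) : stalk M :=
  prob (x ∧ y) / prob y.

Record is_boolean_algebra (M : pmf_signature) : Prop := IsBooleanAlgebra {
  join_meet_absorb : forall x y : event M, (x ∨ y) ∧ y = y;
  meet_join_absorb : forall x y : event M, (x ∧ y) ∨ y = y;
  meet_join_distr  : forall x y z : event M, x ∧ (y ∨ z) = (y ∧ x) ∨ (z ∧ x);
  join_meet_distr  : forall x y z : event M, x ∨ (y ∧ z) = (y ∨ x) ∧ (z ∨ x);
  meet_neg         : forall x : event M, x ∧ ¬ x = ⊥;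
  join_neg         : forall x : event M, x ∨ ¬ x = ⊤
}.

Record is_meadow (M : pmf_signature) : Prop := IsMeadow {
  sadd_assoc : forall x y z : stalk M, (x + y) + z = x + (y + z);
  sadd_comm  : forall x y : stalk M, x + y = y + x;
  sadd_zero  : forall x : stalk M, x + 0 = x;
  sadd_opp   : forall x : stalk M, x + - x = 0;
  smul_assoc : forall x y z : stalk M, (x * y) * z = x * (y * z);
  smul_comm  : forall x y : stalk M, x * y = y * x;
  smul_one   : forall x : stalk M, 1 * x = x;
  smul_add   : forall x y z : stalk M, x * (y + z) = x * y + x * z;
  sinv_inv   : forall x : stalk M, (x⁻¹)⁻¹ = x;
  smul_inv   : forall x : stalk M, x * (x * x⁻¹) = x
}.

Record is_signed (M : pmf_signature) : Prop := IsSigned {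
  sign_one_at  : forall x : stalk M, sign (one_at x) = one_at x;
  sign_zero_at : forall x : stalk M, sign (zero_at x) = zero_at x;
  (* [- (1)]: without parentheses [- 1] is lexed as an integer literal *)
  sign_opp_one : sign (- (1)) = - (1) :> stalk M;
  sign_inv     : forall x : stalk M, sign (x⁻¹) = sign x;
  sign_mul     : forall x y : stalk M, sign (x * y) = sign x * sign y;
  sign_add     : forall x y : stalk M,
    zero_at (sign x - sign y) * (sign (x + y) - sign x) = 0
}.

Record is_pmf (M : pmf_signature) : Prop := IsPmf {
  prob_top  : prob ⊤ = 1 :> stalk M;
  prob_bot  : prob ⊥ = 0 :> stalk M;
  prob_sign : forall x : event M, sign (sign (prob x) + 1) = 1;
  prob_join : forall x y : event M,
    prob (x ∨ y) = prob x + prob y - prob (x ∧ y);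
  prob_meet : forall x y : event M,
    prob (x ∧ y) * prob y * (prob y)⁻¹ = prob (x ∧ y)
}.

Record is_pmf_structure (M : pmf_signature) : Prop := IsPmfStructure {
  pmf_boolean_algebra : is_boolean_algebra M;
  pmf_meadow          : is_meadow M;
  pmf_signed          : is_signed M;
  pmf_pmf             : is_pmf M
}.

Definition independent {M : pmf_signature} (x y : event M) : Prop :=
  prob (x ∧ y) = prob x * prob y.

(* Main.v *)
From Stdlib Require Import Setoid.
Require Import Defs.

(** Since [y ∧ y = y], the factor [cond_prob y y] is [one_at (prob y)], so the criterion is the
    independence equation divided by [prob y]. Multiplying back loses nothing, even when [prob y] is
    zero: [prob_meet] lets [prob (x ∧ y)] absorb [one_at (prob y)], and [smul_inv] does the same for
    [prob y]. *)

Lemma emeet_idem (M : pmf_signature) (HB : is_boolean_algebra M) (x : event M) :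
  (x ∧ x)%ev = x.
Proof.
  (* One absorption law is instantiated so that the other collapses its inner term. *)
  pose proof (join_meet_absorb M HB (x ∧ x)%ev x) as H.
  now rewrite (meet_join_absorb M HB) in H.
Qed.

Lemma ejoin_idem (M : pmf_signature) (HB : is_boolean_algebra M) (x : event M) :
  (x ∨ x)%ev = x.
Proof.
  pose proof (meet_join_absorb M HB (x ∨ x)%ev x) as H.
  now rewrite (join_meet_absorb M HB) in H.
Qed.

(* Distributivity swaps the factors, so expanding [x ∧ (y ∨ y)] commutes them. *)
Lemma emeet_comm (M : pmf_signature) (HB : is_boolean_algebra M)
    (x y : event M) : (x ∧ y)%ev = (y ∧ x)%ev.
Proof.
  rewrite <- (ejoin_idem M HB y) at 1.
  now rewrite (meet_join_distr M HB), (ejoin_idem M HB).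
Qed.

Lemma independent_sym (M : pmf_signature) (HM : is_pmf_structure M)
    (x y : event M) : independent x y <-> independent y x.
Proof.
  destruct HM as [HB HR _ _]; unfold independent.
  now rewrite (emeet_comm M HB y x), (smul_comm M HR (prob y)).
Qed.

Lemma independent_cond_prob (M : pmf_signature) (HM : is_pmf_structure M)
    (x y : event M) :
  independent x y <-> cond_prob x y = prob x * cond_prob y y.
Proof.
  destruct HM as [HB HR _ HP]; unfold independent, cond_prob, sdiv.
  rewrite (emeet_idem M HB), <- (smul_assoc M HR).
  split; intros H.
  - now rewrite H.
  (* Both sides acquire the factor [one_at (prob y)], absorbed on the left by [prob (x ∧ y)] and on
     the right by [prob y]. *)
  - apply (f_equal (fun p => p * prob y)) in H.
    rewrite !(smul_assoc M HR), (smul_comm M HR (prob y)⁻¹),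
      (smul_inv M HR), <- (smul_assoc M HR), (prob_meet M HP) in H.
    exact H.
Qed.

Theorem theorem2 (M : pmf_signature) (HM : is_pmf_structure M) (x y : event M) :
  (independent x y <->
     cond_prob x y = prob x * cond_prob y y) /\
  (independent x y <->
     cond_prob y x = prob y * cond_prob x x).
Proof.
  split.
  - now apply independent_cond_prob.
  (* Independence is symmetric, so this is the first criterion with the events exchanged. *)
  - rewrite (independent_sym M HM); now apply independent_cond_prob.
Qed.
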